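(* Let $N\in\mathbb{N}$. For $z\neq q^{-n}$, $1\leq n\leq 4N-1$, \begin{align*} &\sum_{n=1}^{N}\genfrac{[}{]}{0pt}{}{N}{n}_{q^2}\frac{(-1)^{n-1}z^nq^{n^2}(q^2;q^2)_{n}}{(zq;q^2)_n(1-zq^{2n})}\\ &=\sum_{n=1}^{N}\genfrac{[}{]}{0pt}{}{N}{n}_{q^2}\left(\frac{(q;q)_{2n-2}z^{2n-1}q^{n(2n-1)}}{(zq;q)_{2n-1}}+\frac{(q;q)_{2n-1}z^{2n}q^{n(2n+1)}}{(zq;q)_{2n}}\right)\frac{(q^{2};q^2)_n}{(zq^{2N+1};q^2)_{n}}. \end{align*}
   Context: Here $|q|<1$, $(A;p)_n=(1-A)(1-Ap)\cdots(1-Ap^{n-1})$ with $(A;p)_0=1$, and $\genfrac{[}{]}{0pt}{}{N}{n}_{q^2}=\frac{(q^2;q^2)_N}{(q^2;q^2)_n(q^2;q^2)_{N-n}}$ for $0\le n\le N$ is the $q^2$-binomial coefficient. *)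

(* Defs.v *)
From mathcomp Require Import all_boot all_order all_algebra.
From mathcomp Require Import reals.
From mathcomp Require Import complex.

Set Implicit Arguments.
Unset Strict Implicit.
Unset Printing Implicit Defensive.

Import GRing.Theory.
Local Open Scope ring_scope.

Definition qpoch (F : fieldType) (A p : F) (n : nat) : F :=
  \prod_(0 <= i < n) (1 - A * p ^+ i).

(* Only meaningful for n <= N, since N - n is truncated. *)
Definition qbinom (F : fieldType) (p : F) (N n : nat) : F :=
  qpoch p p N / (qpoch p p n * qpoch p p (N - n)).

(* Main.v *)
Require Import Defs.
From mathcomp Require Import all_boot all_order all_algebra.
From mathcomp Require Import reals.
From mathcomp Require Import complex.
From mathcomp Require Import ring zify.

(**
Put [p = q ^ 2]. Divided by [(p; p)_N], both sides satisfy the same first-order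
recurrence in [N],
  [(1 - z q^(2N+2)) S_(N+1) = S_N + z q^(2N+1) / ((p; p)_N (1 - z q^(2N+1)))],
with [S_0 = 0]. On the left-hand side, the combination of [S_(N+1)] and [S_N]
cancels the factor [1 - z q^(2n)], and what remains is an instance of the
q-Gauss sum; on the right-hand side it telescopes directly. Both
antidifferences come from Gosper's algorithm.
*)

Set Implicit Arguments.
Unset Strict Implicit.
Unset Printing Implicit Defensive.

Import GRing.Theory Num.Theory.
Local Open Scope ring_scope.
Local Open Scope complex_scope.

(** * Finite [q]-Pochhammer products and a telescoping sum *)

Section QPochhammer.

Variable F : fieldType.
Implicit Types (A p : F) (n N : nat).

Lemma qpoch0 A p : qpoch A p 0 = 1.
Proof. by rewrite /qpoch big_geq. Qed.

Lemma qpochS A p n : qpoch A p n.+1 = qpoch A p n * (1 - A * p ^+ n).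
Proof. by rewrite /qpoch big_nat_recr. Qed.

Lemma qpochSl A p n : qpoch A p n.+1 = (1 - A) * qpoch (A * p) p n.
Proof.
rewrite /qpoch big_nat_recl // expr0 mulr1; congr (_ * _).
by apply: eq_bigr => i _; rewrite exprS mulrA.
Qed.

Lemma qpoch_neq0 A p n :
  (forall i, (i < n)%N -> 1 - A * p ^+ i != 0) -> qpoch A p n != 0.
Proof.
elim: n => [|n IH] An0; first by rewrite qpoch0 oner_neq0.
by rewrite qpochS mulf_neq0 ?An0 // IH // => i lin; apply: An0; apply: leqW.
Qed.

(** In both sums of the theorem the binomial comes multiplied by [qpoch p p n]; absorbing that
    factor lets [qpoch p p N] be pulled out of the sum. *)
Lemma qbinom_qpoch p N n : qpoch p p n != 0 ->
  qbinom p N n * qpoch p p n = qpoch p p N / qpoch p p (N - n).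
Proof. by move=> pn0; rewrite /qbinom invfM mulrA mulrAC divfK. Qed.

(** The last term has its own hypothesis because the antidifferences used below contain
    [1 / (p; p)_(N - i)]: this should vanish at [i = N + 1], but truncated subtraction turns it into
    [1]. *)
Lemma telescope_sum0 (t h : nat -> F) N :
  (forall i, (i < N)%N -> t i = h i - h i.+1) -> t N = h N ->
  \sum_(0 <= i < N.+1) t i = h 0%N.
Proof.
move=> tE tN; rewrite big_nat_recr //= tN.
rewrite (@eq_big_nat _ _ _ 0 N t (fun i => - (h i.+1 - h i))) => [|i /andP[_ iN]].
  by rewrite sumrN telescope_sumr // opprB subrK.
by rewrite tE // opprB.
Qed.

End QPochhammer.

(** * First-order recurrences in [N] for the two normalised sums *)

Section Recurrences.

Variables (F : fieldType) (q z : F).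
Hypothesis q_neq1 : forall k, 1 - q ^+ k.+1 != 0.

Local Notation p := (q ^+ 2).

Lemma qpoch_sq_neq0 n : qpoch p p n != 0.
Proof. by apply: qpoch_neq0 => i _; rewrite -exprS -exprM mulnS add2n q_neq1. Qed.

(* Summation indices are shifted: [i] stands for [n - 1] in the theorem. *)
Definition lweight (i : nat) : F :=
  (-1) ^+ i * z ^+ i.+1 * q ^+ (i.+1 ^ 2) / qpoch (z * q) p i.+1.

(** The left summand at [n = i + 1], divided by [(p; p)_N]; [lweight] is its part free of [N]. *)
Definition lterm (N i : nat) : F :=
  lweight i / (qpoch p p (N - i.+1) * (1 - z * q ^+ (2 * i.+1))).

Definition rweight (i : nat) : F :=
  qpoch q q (2 * i) * z ^+ (2 * i).+1 * q ^+ (i.+1 * (2 * i).+1) /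
  qpoch (z * q) q (2 * i).

(** The right summand divided by [(p; p)_N], its two fractions merged by [(1 - z q^(2i+2)) + z
    q^(2i+2) (1 - q^(2i+1)) = 1 - z q^(4i+3)]. *)
Definition rterm (N i : nat) : F :=
  rweight i * (1 - z * q ^+ (4 * i + 3)) /
  ((1 - z * q ^+ (2 * i + 1)) * (1 - z * q ^+ (2 * i + 2)) *
   qpoch p p (N - i.+1) * qpoch (z * q ^+ (2 * N + 1)) p i.+1).

(** The ratio of consecutive weights is rational in [q^(2i)], which reduces each telescoping
    identity to a [field] computation. *)
Lemma lweightS i :
  lweight i.+1 = - (z * q ^+ (2 * i + 3)) / (1 - z * q ^+ (2 * i + 3)) * lweight i.
Proof.
rewrite /lweight [qpoch _ _ i.+2]qpochS invfM -/p.
have -> : (i.+2 ^ 2 = i.+1 ^ 2 + (2 * i + 3))%N by lia.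
have -> : z * q * p ^+ i.+1 = z * q ^+ (2 * i + 3).
  by rewrite -exprM -mulrA -exprS; congr (_ * _ ^+ _); lia.
rewrite exprD [_ ^+ i.+1]exprS [z ^+ i.+2]exprS.
move: (q ^+ (i.+1 ^ 2)) (q ^+ (2 * i + 3)) => a b.
by move: (_ ^-1) (_^-1) => c d; ring.
Qed.

Lemma rweightS i : rweight i.+1 =
  (1 - q ^+ (2 * i + 1)) * (1 - q ^+ (2 * i + 2)) * z ^+ 2 * q ^+ (4 * i + 5) /
  ((1 - z * q ^+ (2 * i + 1)) * (1 - z * q ^+ (2 * i + 2))) * rweight i.
Proof.
rewrite /rweight.
have -> : (2 * i.+1 = (2 * i).+2)%N by lia.
have -> : (i.+2 * (2 * i).+3 = i.+1 * (2 * i).+1 + (4 * i + 5))%N by nia.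
rewrite !qpochS exprD -![z * q * _]mulrA -!exprS.
have -> : (2 * i + 1 = (2 * i).+1)%N by lia.
have -> : (2 * i + 2 = (2 * i).+2)%N by lia.
rewrite !invfM ![z ^+ (2 * i).+3]exprS ![z ^+ (2 * i).+2]exprS.
by move: (_ ^-1) (_^-1) (_^-1) => c d e; ring.
Qed.

Variable N : nat.
Hypothesis z_neq : forall k, (0 < k <= 4 * N + 3)%N -> 1 - z * q ^+ k != 0.

Lemma lterm_rec :
  (1 - z * q ^+ (2 * N + 2)) * \sum_(0 <= i < N.+1) lterm N.+1 i =
  \sum_(0 <= i < N) lterm N i +
    z * q ^+ (2 * N + 1) / (qpoch p p N * (1 - z * q ^+ (2 * N + 1))).
Proof.
(* What remains of [(1 - z q^(2N+2)) * lterm N.+1 i - lterm N i] for [i < N], since [(1 - z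
   q^(2N+2)) - (1 - q^(2(N-i))) = q^(2(N-i)) (1 - z q^(2i+2))]. *)
pose tau i := q ^+ (2 * (N - i)) * lweight i / qpoch p p (N - i).
have tau_sum : \sum_(0 <= i < N.+1) tau i =
    z * q ^+ (2 * N + 1) / (qpoch p p N * (1 - z * q ^+ (2 * N + 1))).
  have zN : 1 - z * q ^+ (2 * N + 1) != 0 by apply: z_neq; lia.
  apply: (mulfI zN); rewrite big_distrr /=.
  (* Gosper antidifference of [(1 - z q^(2N+1)) * tau i]; at [i = 0] its factor [1 - z q] cancels
     the denominator of [lweight 0]. *)
  rewrite (@telescope_sum0 _ _ (fun i => tau i * (1 - z * q ^+ (2 * i + 1)))).
  - rewrite /tau /lweight subn0 qpochS qpoch0 expr0 !mulr1 mul1r muln0 add0n.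
    have z1 : 1 - z * q != 0 by have := z_neq (k := 1); rewrite expr1; apply; lia.
    have := qpoch_sq_neq0 N; move: zN (qpoch _ _ _); move: (2 * N)%N => x.
    rewrite exprD expr1 => zN P P0.
    by field; rewrite zN P0 z1.
  - move=> i iN; rewrite /tau lweightS.
    (* Replacing [N] by [i + k + 1] removes truncated subtraction, so that all powers become
       products of [q^(2i)], [q^(2k)] and constant powers. *)
    have [k NE] : exists k, N = (i + k.+1)%N by exists (N - i.+1)%N; lia.
    have -> : (N - i.+1 = k)%N by lia.
    have -> : (N - i = k.+1)%N by lia.
    have z3 : 1 - z * q ^+ (2 * i + 3) != 0 by apply: z_neq; lia.
    have k1 := q_neq1 (2 * k + 1).
    have -> : (2 * N + 1 = 2 * i + 2 * k + 3)%N by lia.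
    have -> : (2 * i.+1 + 1 = 2 * i + 3)%N by lia.
    rewrite qpochS -exprS -exprM.
    move: k1 z3; have -> : ((2 * k + 1).+1 = 2 * k.+1)%N by lia.
    have -> : (2 * k.+1 = 2 * k + 2)%N by lia.
    have := qpoch_sq_neq0 k; move: (qpoch _ _ _) (lweight i) => P W.
    move: (2 * i)%N (2 * k)%N => a b; rewrite !exprD => P0 k1 z3.
    by field; rewrite P0 k1 z3.
  by rewrite mulrC.
rewrite -tau_sum big_distrr /= !big_nat_recr //= addrA -big_split /=.
have lt i : (i <= N)%N -> 1 - z * q ^+ (2 * i.+1) != 0.
  by move=> iN; apply: z_neq; lia.
congr (_ + _).
  apply: eq_big_nat => i /andP[_ iN]; rewrite /lterm /tau.
  have [k NE] : exists k, N = (i + k.+1)%N by exists (N - i.+1)%N; lia.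
  have -> : (N.+1 - i.+1 = k.+1)%N by lia.
  have -> : (N - i.+1 = k)%N by lia.
  have -> : (N - i = k.+1)%N by lia.
  have k1 := q_neq1 (2 * k + 1).
  have -> : (2 * N + 2 = 2 * i + 2 * k + 4)%N by lia.
  rewrite qpochS -exprS -exprM.
  have zi := lt i (ltnW iN); move: k1 zi.
  have -> : ((2 * k + 1).+1 = 2 * k.+1)%N by lia.
  have -> : (2 * k.+1 = 2 * k + 2)%N by lia.
  have -> : (2 * i.+1 = 2 * i + 2)%N by lia.
  have := qpoch_sq_neq0 k; move: (qpoch _ _ _) (lweight i) => P W.
  move: (2 * i)%N (2 * k)%N => a b; rewrite !exprD => P0 k1 z3.
  by field; rewrite P0 k1 z3.
(* The top index [i = N] has no counterpart in the sum for [N]; there [lterm N.+1 N] alone gives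
   [tau N]. *)
have := lt N (leqnn N).
rewrite /lterm /tau !subnn muln0 expr0 qpoch0 !mul1r divr1.
have -> : (2 * N.+1 = 2 * N + 2)%N by lia.
by move=> zN; rewrite mulrC divfK.
Qed.

Lemma rterm_rec :
  (1 - z * q ^+ (2 * N + 2)) * \sum_(0 <= i < N.+1) rterm N.+1 i =
  \sum_(0 <= i < N) rterm N i +
    z * q ^+ (2 * N + 1) / (qpoch p p N * (1 - z * q ^+ (2 * N + 1))).
Proof.
(* [K] is the antidifference of [D], and [K 0] is the inhomogeneous term of the recurrence. *)
pose K i := q ^+ (2 * (N - i)) * rweight i /
  (qpoch p p (N - i) * qpoch (z * q ^+ (2 * N + 1)) p i.+1).
(* The test [i < N] discards [rterm N N], which truncated subtraction does not make zero. *)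
pose D i := (1 - z * q ^+ (2 * N + 2)) * rterm N.+1 i -
  (if (i < N)%N then rterm N i else 0).
have zN : 1 - z * q ^+ (2 * N + 1) != 0 by apply: z_neq; lia.
have zN2 : 1 - z * q ^+ (2 * N + 2) != 0 by apply: z_neq; lia.
have K0 : K 0%N = z * q ^+ (2 * N + 1) / (qpoch p p N * (1 - z * q ^+ (2 * N + 1))).
  rewrite /K /rweight subn0 qpochS !qpoch0 !expr0 expr1 !mulr1 !mul1r mul1n muln0 expr1.
  by rewrite divr1 (exprD _ (2 * N)) expr1 mulrCA.
(* The products based at [z q^(2N+1)] and [z q^(2N+3)] are both reduced to [(z q^(2N+3); p)_i], a
   single atom for [field]. *)
have poch1 i : qpoch (z * q ^+ (2 * N + 1)) p i.+1 =
    (1 - z * q ^+ (2 * N + 1)) * qpoch (z * q ^+ (2 * N + 3)) p i.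
  by rewrite qpochSl -mulrA -exprD; congr (_ * qpoch (_ * _ ^+ _) _ _); lia.
have poch2 i : qpoch (z * q ^+ (2 * N + 3)) p i.+1 =
    qpoch (z * q ^+ (2 * N + 3)) p i * (1 - z * q ^+ (2 * N + 2 * i + 3)).
  rewrite qpochS -exprM -mulrA -exprD.
  by congr (_ * (1 - _ * _ ^+ _)); lia.
have poch3 i : (i <= N)%N -> qpoch (z * q ^+ (2 * N + 3)) p i != 0.
  move=> iN; apply: qpoch_neq0 => j ji.
  by rewrite -exprM -mulrA -exprD; apply: z_neq; lia.
have D_sum : \sum_(0 <= i < N.+1) D i = K 0%N.
  apply: telescope_sum0 => [i iN|]; rewrite /D /K /rterm.
    rewrite iN rweightS.
    have [k NE] : exists k, N = (i + k.+1)%N by exists (N - i.+1)%N; lia.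
    have -> : (N.+1 - i.+1 = k.+1)%N by lia.
    have -> : (N - i.+1 = k)%N by lia.
    have -> : (N - i = k.+1)%N by lia.
    have -> : (2 * N.+1 + 1 = 2 * N + 3)%N by lia.
    have z1 : 1 - z * q ^+ (2 * i + 1) != 0 by apply: z_neq; lia.
    have z2 : 1 - z * q ^+ (2 * i + 2) != 0 by apply: z_neq; lia.
    have z3 : 1 - z * q ^+ (2 * N + 2 * i + 3) != 0 by apply: z_neq; lia.
    have Q0 := poch3 i (ltnW iN).
    have k1 := q_neq1 (2 * k + 1).
    rewrite !poch1 !poch2 qpochS -exprS -exprM.
    move: Q0; move: (qpoch (z * _) p i) => Q Q0.
    move: k1 z1 z2 z3 zN zN2; have -> : ((2 * k + 1).+1 = 2 * k.+1)%N by lia.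
    have -> : (2 * k.+1 = 2 * k + 2)%N by lia.
    have -> : (4 * i = 2 * i + 2 * i)%N by lia.
    have -> : (2 * N = 2 * i + 2 * k + 2)%N by lia.
    have := qpoch_sq_neq0 k; move: (qpoch _ _ _) (rweight i) => P G.
    move: (2 * i)%N (2 * k)%N => a b; rewrite !exprD => P0 k1 z1 z2 z3 zN zN2.
    by field; rewrite P0 Q0 k1 z1 z2 z3 zN.
  (* At [i = N] the numerator [1 - z q^(4N+3)] cancels the last factor of
     [(z q^(2N+3); p)_(N+1)]. *)
  rewrite ltnn !subnn muln0 expr0 qpoch0 subr0.
  have -> : (2 * N.+1 + 1 = 2 * N + 3)%N by lia.
  have z3 : 1 - z * q ^+ (2 * N + 2 * N + 3) != 0 by apply: z_neq; lia.
  have Q0 := poch3 N (leqnn N).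
  rewrite !poch1 !poch2; move: Q0; move: (qpoch (z * _) p N) => Q Q0.
  move: z3 zN zN2; have -> : (4 * N = 2 * N + 2 * N)%N by lia.
  move: (rweight N) (2 * N)%N => G a; rewrite !exprD => z3 zN zN2.
  by field; rewrite Q0 z3 zN zN2.
rewrite -K0 -D_sum /D big_split /= sumrN -big_distrr /=.
rewrite [X in _ = _ + (_ - X)]big_nat_recr //= ltnn addr0.
rewrite [X in _ = _ + (_ - X)](@eq_big_nat _ _ _ 0 N _ (rterm N)).
  by rewrite [RHS]addrC subrK.
by move=> i /andP[_ ->].
Qed.

End Recurrences.

(** * Induction on [N], then return to the [q]-binomial form *)

Lemma sum_lterm_rterm (F : fieldType) (q z : F) N :
  (forall k, 1 - q ^+ k.+1 != 0) ->
  (forall k, (0 < k <= 4 * N - 1)%N -> 1 - z * q ^+ k != 0) ->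
  \sum_(0 <= i < N) lterm q z N i = \sum_(0 <= i < N) rterm q z N i.
Proof.
move=> q_neq1; elim: N => [|N IH] z_neq; first by rewrite !big_geq.
(* As [4(N+1) - 1 = 4N + 3], this is exactly the range required by the two recurrences. *)
have z_neq' k : (0 < k <= 4 * N + 3)%N -> 1 - z * q ^+ k != 0.
  by move=> kN; apply: z_neq; lia.
have zN2 : 1 - z * q ^+ (2 * N + 2) != 0 by apply: z_neq; lia.
apply: (mulfI zN2); rewrite lterm_rec // rterm_rec //; congr (_ + _).
by apply: IH => k kN; apply: z_neq; lia.
Qed.

Theorem theorem1p3 (R : realType) (q z : R[i]) (N : nat)
  (hq : `|q| < 1)
  (hz : forall n : nat, (1 <= n <= 4 * N - 1)%N -> q != 0 -> z != q ^- n) :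
  \sum_(1 <= n < N.+1)
     qbinom (q ^+ 2) N n *
     (((-1) ^+ (n - 1) * z ^+ n * q ^+ (n ^ 2) * qpoch (q ^+ 2) (q ^+ 2) n) /
      (qpoch (z * q) (q ^+ 2) n * (1 - z * q ^+ (2 * n))))
  = \sum_(1 <= n < N.+1)
     qbinom (q ^+ 2) N n *
     ((qpoch q q (2 * n - 2) * z ^+ (2 * n - 1) * q ^+ (n * (2 * n - 1))) /
        qpoch (z * q) q (2 * n - 1) +
      (qpoch q q (2 * n - 1) * z ^+ (2 * n) * q ^+ (n * (2 * n + 1))) /
        qpoch (z * q) q (2 * n)) *
     (qpoch (q ^+ 2) (q ^+ 2) n /
      qpoch (z * q ^+ (2 * N + 1)) (q ^+ 2) n).
Proof.
have q_neq1 k : 1 - q ^+ k.+1 != 0.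
  apply/eqP => /eqP; rewrite subr_eq0 => /eqP q1.
  have : `|q| ^+ k.+1 < 1 by rewrite exprn_ilt1.
  by rewrite -normrX -q1 normr1 Order.POrderTheory.ltxx.
have z_neq k : (0 < k <= 4 * N - 1)%N -> 1 - z * q ^+ k != 0.
  (* For [q = 0] the hypothesis [hz] is vacuous, but [q^k = 0] because [k > 0]. *)
  move=> kN; have [q0|q0] := eqVneq q 0.
    by rewrite q0 expr0n eqn0Ngt; case/andP: kN => -> _; rewrite mulr0 subr0 oner_neq0.
  apply: contra (hz k kN q0); rewrite subr_eq0 => /eqP zq.
  by rewrite -[_ ^- _]mul1r zq mulfK // expf_neq0.
rewrite !big_add1 /=.
transitivity (qpoch (q ^+ 2) (q ^+ 2) N * \sum_(0 <= i < N) lterm q z N i).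
  rewrite big_distrr /=; apply: eq_big_nat => i /andP[_ iN].
  have := qbinom_qpoch N (qpoch_sq_neq0 q_neq1 i.+1).
  move: (qbinom _ _ _) => B BE; rewrite subn1 /=.
  rewrite [_ * qpoch _ _ i.+1]mulrC -!mulrA [LHS]mulrA.
  by rewrite BE /lterm /lweight !invfM; ring.
rewrite sum_lterm_rterm // big_distrr /=; apply: eq_big_nat => i /andP[_ iN].
have := qbinom_qpoch N (qpoch_sq_neq0 q_neq1 i.+1).
move: (qbinom _ _ _) => B BE.
rewrite [RHS]mulrAC [X in _ = X * _]mulrA BE /rterm /rweight.
have -> : (2 * i.+1 - 2 = 2 * i)%N by lia.
have -> : (2 * i.+1 - 1 = (2 * i).+1)%N by lia.
have -> : (i.+1 * (2 * i.+1 + 1) = i.+1 * (2 * i).+1 + (2 * i + 2))%N by nia.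
have -> : (2 * i.+1 = (2 * i).+2)%N by lia.
rewrite ![qpoch _ q _.+2]qpochS ![qpoch _ q _.+1]qpochS -![z * q * _]mulrA -!exprS.
have z1 : 1 - z * q ^+ (2 * i).+1 != 0 by apply: z_neq; lia.
have z2 : 1 - z * q ^+ (2 * i).+2 != 0 by apply: z_neq; lia.
have -> : (4 * i + 3 = (2 * i).+1 + (2 * i).+2)%N by lia.
have -> : (2 * i + 1 = (2 * i).+1)%N by lia.
have -> : (2 * i + 2 = (2 * i).+2)%N by lia.
(* With the common powers and products abstracted, only the merging of the two fractions into
   [rterm] is left to [field]. *)
move: (i.+1 * (2 * i).+1)%N => m.
rewrite (exprD q m) (exprD q (2 * i).+1 (2 * i).+2) [z ^+ (2 * i).+2]exprS.
move: z1 z2; rewrite [q ^+ (2 * i).+2]exprS !invfM.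
move: (qpoch (z * q) q (2 * i))^-1 (qpoch _ _ (N - i.+1))^-1 => c1 c2.
move: (qpoch _ _ i.+1)^-1 (qpoch _ _ N) (qpoch q q (2 * i)) => c3 P Q.
move: (q ^+ (2 * i).+1) (z ^+ (2 * i).+1) => y t z1 z2.
by field; rewrite z1 z2.
Qed.
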